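(* Let $(X,\succcurlyeq^X)$ and $(Y,\succcurlyeq^Y)$ be partially ordered topological vector spaces with dual spaces $X^*$ and $Y^*$, respectively. Let $C$ be a nonempty compact subset of $X$ and $D$ a nonempty subset of $Y$. Let $f:C\to X^*$, $g:D\to Y^*$ and $A:X\to Y$ be (not necessarily linear) mappings. Suppose that the following conditions hold: (1) $f$ and $g$ are both order-positive; (2) for every $x\in C$, the set $m({}_fA_g)(x)$ is a nonempty closed subset of $C$; (3) there are elements $x'\in C$ and $u'\in m({}_fA_g)(x')$ satisfying $x'\preccurlyeq^X u'$; (4) $A$ is order-increasing. Then the nonlinear split variational inequality problem $\mathrm{NSVI}(f,C,A,g,D)$ has a solution, and its solution set $\mathcal{S}(f,A,g)$ satisfies: (i) $(\mathcal{S}(f,A,g),\succcurlyeq^X)$ is a nonempty inductive poset; (ii) $(\mathcal{S}(f,A,g)\cap[x'),\succcurlyeq^X)$ is a nonempty inductive poset; (i)' $\mathrm{NSVI}(f,C,A,g,D)$ has an $\succcurlyeq^X$-maximal solution; (ii)' $\mathrm{NSVI}(f,C,A,g,D)$ has an $\succcurlyeq^X$-maximal solution $x^*$ with $x^*\succcurlyeq^X x'$.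
   Context: All vector spaces are real. A partially ordered topological vector space is a topological vector space $X$ with a partial order $\succcurlyeq$ such that: $x\succcurlyeq y$ implies $x+z\succcurlyeq y+z$ for all $x,y,z\in X$; $x\succcurlyeq y$ implies $\alpha x\succcurlyeq\alpha y$ for all $x,y\in X$ and real $\alpha\ge0$; and for every $u\in X$ the sets $[u)=\{x\in X:x\succcurlyeq u\}$ and $(u]=\{x\in X:x\preccurlyeq u\}$ are closed. Here $x\preccurlyeq y$ means $y\succcurlyeq x$. The dual $X^*$ is the space of continuous linear functionals on $X$, and $\langle\cdot,\cdot\rangle$ denotes the pairing between a space and its dual. A mapping $f:C\to X^*$, with $C\subseteq X$, is order-positive if, for all $x,y\in C$ with $x\preccurlyeq^X y$ and every $z\in X$, $\langle f(x),z\rangle\ge0$ implies $\langle f(y),z\rangle\ge 0$; order-positivity of $g:D\to Y^*$ is defined in the same way in $(Y,\succcurlyeq^Y)$. $A:X\to Y$ is order-increasing if $x\preccurlyeq^X y$ implies $Ax\preccurlyeq^Y Ay$. A poset is inductive if every (nonempty) chain in it has an upper bound in it. The problem $\mathrm{NSVI}(f,C,A,g,D)$ is: find $x_*\in C$ such that $\langle f(x_* ),x-x_*\rangle\ge0$ for all $x\in C$, and such that $y_*=Ax_*$ belongs to $D$ and satisfies $\langle g(y_* ),y-y_*\rangle\ge0$ for all $y\in D$. Such $x_*$ is a solution; $\mathcal{S}(f,A,g)\subseteq C$ is the set of solutions; an $\succcurlyeq^X$-maximal solution is a maximal element of $(\mathcal{S}(f,A,g),\succcurlyeq^X)$. For $x\in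 C$, $$m({}_fA_g)(x)=\{z\in C:\ \langle f(x),z\rangle=\min\{\langle f(x),t\rangle:t\in C\}\ \text{and}\ \langle g(Ax),Az\rangle=\min\{\langle g(Ax),s\rangle:s\in D\}\},$$ where the equalities include the requirement that the minima exist. Since $g$ is defined only on $D$, hypothesis (2) implicitly includes that $Ax\in D$ for every $x\in C$. *)

(* Defs.v *)
From HB Require Import structures.
From mathcomp Require Import all_boot all_order all_algebra.
From mathcomp Require Import all_classical all_reals all_analysis.

Set Implicit Arguments.
Unset Strict Implicit.
Unset Printing Implicit Defensive.

Import Order.TTheory GRing.Theory Num.Theory.
Import numFieldNormedType.Exports.

Local Open Scope classical_set_scope.
Local Open Scope ring_scope.

(* The order is carried by [Num.POrderedZmodule], which by itself is only a
   partial order (displayed by the ring notations <=, <) next to an additive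
   group; compatibility with the vector space and the topology is required
   here.  Neither local convexity nor separation is assumed. *)
HB.mixin Record TopologicalLmodule_isPOrdered (R : realType) X
    & TopologicalLmodule R X & Num.POrderedZmodule X := {
  potvs_leD2r : forall x y z : X, y <= x -> y + z <= x + z ;
  potvs_leZ2l : forall (a : R) (x y : X), 0 <= a -> y <= x -> a *: y <= a *: x ;
  potvs_closed_ge : forall u : X, closed [set x | u <= x] ;
  potvs_closed_le : forall u : X, closed [set x | x <= u]
}.

#[short(type="potvsType")]
HB.structure Definition POTVS (R : realType) :=
  {X of TopologicalLmodule R X & Num.POrderedZmodule X
        & TopologicalLmodule_isPOrdered R X}.

Record topo_dual (R : realType) (X : topologicalLmodType R) := Dual {
  dual_fun : {linear X -> R^o} ;
  dual_continuous : continuous dual_fun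
}.

Definition pairing (R : realType) (X : topologicalLmodType R)
  (p : topo_dual X) (z : X) : R := dual_fun p z.

Notation "⟨ p , z ⟩" := (pairing p z)
  (at level 0, p at level 99, z at level 99, format "⟨ p ,  z ⟩") : ring_scope.

Definition upper_set d (T : porderType d) (u : T) : set T :=
  [set x | (u <= x)%O].

Definition is_minimum (R : realType) (E : set R) (m : R) : Prop :=
  E m /\ lbound E m.

Definition chain d (T : porderType d) (K : set T) : Prop :=
  total_on K (fun x y => (x <= y)%O).

(* Nonempty chains only, so that the empty poset is inductive as well. *)
Definition inductive_poset d (T : porderType d) (S : set T) : Prop :=
  forall K : set T, K `<=` S -> K !=set0 -> chain K -> S `&` ubound K !=set0.

Definition maximal_element d (T : porderType d) (S : set T) (x : T) : Prop :=
  S x /\ forall y, S y -> (x <= y)%O -> y = x.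

Definition order_increasing d d' (T : porderType d) (T' : porderType d')
  (A : T -> T') : Prop := forall x y, (x <= y)%O -> (A x <= A y)%O.

(* Maps f : C -> X^* (the dual) are represented by total functions X -> X^* whose values
   outside C are never used. *)
Definition order_positive (R : realType) (X : potvsType R) (C : set X)
  (f : X -> topo_dual X) : Prop :=
  forall x y, C x -> C y -> x <= y ->
  forall z : X, 0 <= ⟨f x, z⟩ -> 0 <= ⟨f y, z⟩.

Section split_variational_inequality.
Context (R : realType) (X Y : potvsType R).
Context (f : X -> topo_dual X) (C : set X) (A : X -> Y).
Context (g : Y -> topo_dual Y) (D : set Y).

Definition NSVI : set X := [set xs |
  [/\ C xs,
      forall x, C x -> 0 <= ⟨f xs, x - xs⟩,
      D (A xs) &
      forall y, D y -> 0 <= ⟨g (A xs), y - A xs⟩ ]].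

Definition argmin_fAg (x : X) : set X := [set z |
  [/\ C z,
      is_minimum [set ⟨f x, t⟩ | t in C] ⟨f x, z⟩ &
      is_minimum [set ⟨g (A x), s⟩ | s in D] ⟨g (A x), A z⟩ ]].

End split_variational_inequality.

(* Main.v *)
Require Import Defs.
From HB Require Import structures.
From mathcomp Require Import all_boot all_order all_algebra.
From mathcomp Require Import all_classical all_reals all_analysis.

Set Implicit Arguments.
Unset Strict Implicit.
Unset Printing Implicit Defensive.

Import Order.TTheory GRing.Theory Num.Theory.
Import numFieldNormedType.Exports.

Local Open Scope classical_set_scope.
Local Open Scope ring_scope.

(** A solution of the problem is a point [x] of [C] with [x \in m x], where
    [m = argmin_fAg f C A g D]: the two variational inequalities at [x] say
    that [x] minimizes [f x] over [C] and that [A x] minimizes [g (A x)] over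
    [D].

    Minimality of [z] for a functional [p] means [0 <= ⟨p, t - z⟩] for all
    admissible [t], and order-positivity carries exactly such inequalities
    from [f x] to [f y] when [x <= y], and likewise from [g (A x)] to
    [g (A y)] since [A] is increasing. So [m] is isotone for inclusion
    ([argmin_isotone]): once a point minimizes, it keeps minimizing further
    up. Hence a point [u'] of [m x'] above [x'] lies in [m u'], that is, [u']
    is already a solution above [x'].

    For a nonempty chain [K] of fixed points of [m], compactness of [C] and
    closedness of the cones [[k, +oo)] give an upper bound [p] of [K] in the
    closure of [K] ([compact_chain_ubound]). Every [k] in [K] lies in
    [m k `<=` m p], and [m p] is closed, so [p] lies in [m p]: the solutions
    form an inductive poset ([fixpoints_inductive]). Restricting to an upper
    set keeps inductivity, and Zorn's lemma yields maximal solutions; one that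
    is maximal among the solutions above [x'] is maximal among all. *)

Lemma zorn_maximal d (T : porderType d) (S : set T) :
  S !=set0 -> inductive_poset S -> exists x, maximal_element S x.
Proof.
move=> [x0 Sx0] indS.
have [||||x xmax] := @Zorn S (fun x y => (val x <= val y)%O).
- by move=> x /=.
- by move=> x y z /=; exact: le_trans.
- by move=> x y /= xy yx; apply/val_inj/le_anti; rewrite xy yx.
- move=> K Kchain; have [->|/set0P [k Kk]] := eqVneq K set0.
    by exists (SigSub (mem_set Sx0)) => s.
  have [||| p [Sp ubp]] := indS (val @` K).
  + by move=> _ [y _ <-]; exact: set_valP.
  + by exists (val k), k.
  + by move=> _ _ [y Ky <-] [z Kz <-]; exact: Kchain.
  + by exists (SigSub (mem_set Sp)) => s Ks; apply: ubp; exists s.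
exists (val x); split; first exact: set_valP.
by move=> y Sy xy; have /(congr1 val) := xmax (SigSub (mem_set Sy)) xy.
Qed.

Lemma inductive_upper_set d (T : porderType d) (S : set T) (u : T) :
  inductive_poset S -> inductive_poset (S `&` upper_set u).
Proof.
move=> indS K KS [k Kk] Kchain.
have [|||p [Sp ubp]] := indS K; [by move=> y /KS[]|by exists k|by []|].
exists p; split=> //; split=> //.
by have [_ uk] := KS _ Kk; exact: le_trans uk (ubp _ Kk).
Qed.

Lemma maximal_upper_set d (T : porderType d) (S : set T) (u x : T) :
  maximal_element (S `&` upper_set u) x -> maximal_element S x /\ (u <= x)%O.
Proof.
move=> [[Sx ux] xmax]; split=> //; split=> // y Sy xy.
by apply: xmax => //; split=> //; exact: le_trans ux xy.
Qed.

(** A chain, indexed by itself, is a net; a cluster point of it in the compact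
    set belongs to every closed cone [[k, +oo)], as these contain the tails of
    the net. Membership in the closure is what later allows closed conditions
    on the chain to pass to its bound. *)
Lemma compact_chain_ubound (R : realType) (X : potvsType R) (C K : set X) :
  compact C -> K `<=` C -> K !=set0 -> chain K ->
  exists p, [/\ C p, closure K p & ubound K p].
Proof.
move=> Ccpt KC [k0 Kk0] Kchain.
pose tail k := K `&` [set x | k <= x].
have tailF : ProperFilter (filter_from K tail).
  apply: filter_from_proper; last by move=> k Kk; exists k; split=> /=.
  apply: filter_from_filter => [|i j Ki Kj]; first by exists k0.
  have [ij|ji] := Kchain _ _ Ki Kj.
    by exists j => // x [Kx jx]; do 2!split=> //=; exact: le_trans ij jx.
  by exists i => // x [Kx ix]; do 2!split=> //=; exact: le_trans ji ix.
have tailC : filter_from K tail C by exists k0 => // x [/KC].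
have [p [Cp]] := Ccpt _ tailF tailC.
rewrite clusterE => clp; exists p; split=> //.
  by apply: clp; exists k0 => // x [].
move=> k Kk; apply: (potvs_closed_ge k).
by apply: clp; exists k => // x [].
Qed.

(** [m p] is a closed set containing [k \in m k `<=` m p] for every [k] in the
    chain, hence it contains the bound [p] taken in the closure of the chain. *)
Lemma fixpoints_inductive (R : realType) (X : potvsType R) (C : set X)
    (m : X -> set X) :
  compact C -> (forall x, C x -> closed (m x)) ->
  (forall x y, C x -> C y -> x <= y -> m x `<=` m y) ->
  inductive_poset [set x | C x /\ m x x].
Proof.
move=> Ccpt mcl misot K Kfix K0 Kchain.
have KC : K `<=` C by move=> x /Kfix[].
have [p [Cp clp ubp]] := compact_chain_ubound Ccpt KC K0 Kchain.
exists p; split=> //; split=> //; apply: (mcl _ Cp).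
apply: closureS clp => k Kk; have [Ck mk] := Kfix _ Kk.
exact: misot (ubp _ Kk) _ mk.
Qed.

(** This form of minimality involves the functional only through the sign of
    its values, which is all that order-positivity controls. *)
Lemma is_minimum_pairing (R : realType) (X : topologicalLmodType R)
    (E : set X) (p : topo_dual X) (z : X) : E z ->
  is_minimum [set ⟨p, t⟩ | t in E] ⟨p, z⟩ <->
  (forall t, E t -> 0 <= ⟨p, t - z⟩).
Proof.
move=> Ez; have sub t : (0 <= ⟨p, t - z⟩) = (⟨p, z⟩ <= ⟨p, t⟩).
  by rewrite /pairing linearB subr_ge0.
split=> [[_ zmin] t Et|zmin]; first by rewrite sub; apply: zmin; exists t.
by split; [exists z|move=> _ [t Et <-]; rewrite -sub; exact: zmin].
Qed.

Lemma is_minimum_order_positive (R : realType) (X : potvsType R) (E : set X)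
    (f : X -> topo_dual X) (x y z : X) :
  order_positive E f -> E x -> E y -> x <= y -> E z ->
  is_minimum [set ⟨f x, t⟩ | t in E] ⟨f x, z⟩ ->
  is_minimum [set ⟨f y, t⟩ | t in E] ⟨f y, z⟩.
Proof.
move=> fpos Ex Ey xy Ez /(is_minimum_pairing _ Ez) zmin.
by apply/(is_minimum_pairing _ Ez) => t /zmin; exact: fpos.
Qed.

Lemma argmin_isotone (R : realType) (X Y : potvsType R) (C : set X)
    (D : set Y) (f : X -> topo_dual X) (g : Y -> topo_dual Y) (A : X -> Y)
    (x y : X) :
  order_positive C f -> order_positive D g -> (forall x, C x -> D (A x)) ->
  order_increasing A -> C x -> C y -> x <= y ->
  argmin_fAg f C A g D x `<=` argmin_fAg f C A g D y.
Proof.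
move=> fpos gpos ACD Aincr Cx Cy xy z [Cz fmin gmin]; split=> //.
  exact: is_minimum_order_positive fmin.
have [DAx DAy DAz] := And3 (ACD _ Cx) (ACD _ Cy) (ACD _ Cz).
exact: is_minimum_order_positive gpos DAx DAy (Aincr _ _ xy) DAz gmin.
Qed.

Lemma NSVI_fixpoints (R : realType) (X Y : potvsType R) (C : set X)
    (D : set Y) (f : X -> topo_dual X) (g : Y -> topo_dual Y) (A : X -> Y) :
  (forall x, C x -> D (A x)) ->
  NSVI f C A g D = [set x | C x /\ argmin_fAg f C A g D x x].
Proof.
move=> ACD; apply/seteqP; split=> [x [Cx fx DAx gx]|x [Cx [_ fx gx]]].
  by split=> //; split=> //; exact/is_minimum_pairing.
by split; [|exact/is_minimum_pairing|exact: ACD|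
            apply/is_minimum_pairing => //; exact: ACD].
Qed.

Theorem corollary3p3 (R : realType) (X Y : potvsType R)
    (C : set X) (D : set Y)
    (f : X -> topo_dual X) (g : Y -> topo_dual Y) (A : X -> Y)
    (C_nonempty : C !=set0) (C_compact : compact C) (D_nonempty : D !=set0)
    (f_pos : order_positive C f) (g_pos : order_positive D g)
    (A_CD : forall x, C x -> D (A x))
    (m_nonempty : forall x, C x -> argmin_fAg f C A g D x !=set0)
    (m_closed : forall x, C x -> closed (argmin_fAg f C A g D x))
    (x' u' : X) (Cx' : C x') (mu' : argmin_fAg f C A g D x' u')
    (x'_le_u' : x' <= u')
    (A_incr : order_increasing A) :
  [/\ exists x, NSVI f C A g D x,
      NSVI f C A g D !=set0 /\ inductive_poset (NSVI f C A g D),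
      NSVI f C A g D `&` upper_set x' !=set0 /\
        inductive_poset (NSVI f C A g D `&` upper_set x'),
      exists xs, maximal_element (NSVI f C A g D) xs &
      exists xs, maximal_element (NSVI f C A g D) xs /\ x' <= xs].
Proof.
have isot x y : C x -> C y -> x <= y ->
    argmin_fAg f C A g D x `<=` argmin_fAg f C A g D y.
  exact: argmin_isotone.
have Cu' : C u' by case: mu'.
have Su' : NSVI f C A g D u'.
  by rewrite NSVI_fixpoints//; split=> //; exact: isot mu'.
have indS : inductive_poset (NSVI f C A g D).
  by rewrite NSVI_fixpoints//; exact: fixpoints_inductive.
have S0 : NSVI f C A g D !=set0 by exists u'.
have S'0 : NSVI f C A g D `&` upper_set x' !=set0 by exists u'.
have indS' := inductive_upper_set (u := x') indS.
split=> //; first exact: zorn_maximal.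
have [xs /maximal_upper_set xsmax] := zorn_maximal S'0 indS'.
by exists xs.
Qed.
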